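(* Let $A\in\mathbb{R}^{m\times n}$, $b\in\mathbb{R}^m$, an initial guess $x_0\in\mathbb{R}^n$, and nonsingular matrices (preconditioners) $L_1,L_2,\dots\in\mathbb{R}^{n\times n}$ be given, and let $Z_k=[z_1,\dots,z_k]$ be the matrix generated by $k$ steps of the flexible Golub–Kahan (FGK) process (defined in the context). Then: (i) the FLSQR solution $x_k$ obtained at the $k$th step minimizes the residual norm $\|Ax-b\|_2$ over all $x\in x_0+\mathrm{span}\{z_1,\dots,z_k\}$; (ii) the FLSMR solution $x_k$ obtained at the $k$th step minimizes $\|A^\top(Ax-b)\|_2$ over all $x\in x_0+\mathrm{span}\{z_1,\dots,z_k\}$.
   Context: All arithmetic is exact and over the reals; $\|\cdot\|_2$ is the Euclidean norm. Flexible Golub–Kahan (FGK) process. Let $r_0=b-Ax_0$, $\beta_1=\|r_0\|_2$ and $u_1=r_0/\beta_1$ (when $x_0=0$ this is $u_1=b/\|b\|_2$). For $i=1,2,\dots$: 1. $w=A^\top u_i$; $t_{ji}=w^\top v_j$ for $j=1,\dots,i-1$; replace $w$ by $w-\sum_{j=1}^{i-1}t_{ji}v_j$; set $t_{ii}=\|w\|_2$ and $v_i=w/t_{ii}$. 2. $z_i=L_i^{-1}v_i$; $w=Az_i$; $m_{ji}=w^\top u_j$ for $j=1,\dots,i$; replace $w$ by $w-\sum_{j=1}^{i}m_{ji}u_j$; set $m_{i+1,i}=\|w\|_2$ and $u_{i+1}=w/m_{i+1,i}$. The process after $k$ steps consists of steps 1–2 for $i=1,\dots,k$, together with step 1 for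 $i=k+1$ (which produces $v_{k+1}$ and the entries $t_{j,k+1}$; it is needed only for FLSMR). It is assumed that no breakdown occurs, i.e. all the normalization constants $\beta_1$, $t_{ii}$, $m_{i+1,i}$ that are divided by are nonzero. Put $Z_k=[z_1,\dots,z_k]\in\mathbb{R}^{n\times k}$, $U_{k+1}=[u_1,\dots,u_{k+1}]$, $V_{k+1}=[v_1,\dots,v_{k+1}]$ (the last two have orthonormal columns). Let $M_k\in\mathbb{R}^{(k+1)\times k}$ be the upper Hessenberg matrix with entries $m_{ji}$ ($j\le i+1$), zero otherwise, and $T_{k+1}\in\mathbb{R}^{(k+1)\times(k+1)}$ the upper triangular matrix with entries $t_{ji}$ ($j\le i$), zero otherwise. The process yields $AZ_k=U_{k+1}M_k$ and $A^\top U_{k+1}=V_{k+1}T_{k+1}$. Let $e_1$ be the first column of the identity matrix of order $k+1$. FLSQR: the $k$th FLSQR iterate (solution at step $k$) is $x_k=x_0+Z_ky_k$ with $y_k=\arg\min_{y\in\mathbb{R}^k}\|M_ky-\beta_1e_1\|_2^2$. FLSMR: the $k$th FLSMR iterate (solution at step $k$) is $x_k=x_0+Z_ky_k$ with $y_k=\arg\min_{y\in\mathbb{R}^k}\|T_{k+1}M_ky-\beta_1t_{11}e_1\|_2^2$. *)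

(* Defs.v *)
From mathcomp Require Import all_boot all_order all_algebra.
From mathcomp Require Import reals.

Set Implicit Arguments.
Unset Strict Implicit.
Unset Printing Implicit Defensive.

Import GRing.Theory Num.Theory.
Local Open Scope ring_scope.

Section Minimization.
Variable R : rcfType.

Definition dot (p : nat) (x y : 'cV[R]_p) : R := (x^T *m y) 0 0.

(* The Euclidean norm; the norm that MathComp-Analysis puts on matrices is the
   sup norm. *)
Definition norm2 (p : nat) (x : 'cV[R]_p) : R :=
  Num.sqrt (\sum_(i < p) x i 0 ^+ 2).

Definition minimizes (X : Type) (S : X -> Prop) (f : X -> R) (x : X) : Prop :=
  S x /\ forall x' : X, S x' -> f x <= f x'.

End Minimization.

(* All sequences are indexed from 1: fgk_u d i is u_i, fgk_t d j i is t_{ji} and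
   fgk_m d j i is m_{ji}. The values at index 0, and those at indices that the
   process has not reached, are irrelevant. *)
Record fgk_data (R : rcfType) (m n : nat) := FGKData {
  fgk_beta1 : R;
  fgk_u : nat -> 'cV[R]_m;
  fgk_v : nat -> 'cV[R]_n;
  fgk_z : nat -> 'cV[R]_n;
  fgk_t : nat -> nat -> R;
  fgk_m : nat -> nat -> R
}.

Section FGK.
Variables (R : rcfType) (m n : nat).
Variables (A : 'M[R]_(m, n)) (b : 'cV[R]_m) (x0 : 'cV[R]_n).
Variable L : nat -> 'M[R]_n.
Variable d : fgk_data R m n.

(* The conditions "_ != 0" below express that no breakdown occurs. *)

Definition fgk_init : Prop :=
  let r0 := b - A *m x0 in
  [/\ fgk_beta1 d = norm2 r0,
      fgk_beta1 d != 0
    & fgk_u d 1%N = (fgk_beta1 d)^-1 *: r0].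

(* The coefficients t_{ji}, j < i, are all computed from the initial w (classical
   Gram-Schmidt); w' is the vector that replaces w. *)
Definition fgk_step1 (i : nat) : Prop :=
  let w := A^T *m fgk_u d i in
  let w' := w - \sum_(1 <= j < i) fgk_t d j i *: fgk_v d j in
  [/\ forall j : nat, (1 <= j < i)%N -> fgk_t d j i = dot w (fgk_v d j),
      fgk_t d i i = norm2 w',
      fgk_t d i i != 0
    & fgk_v d i = (fgk_t d i i)^-1 *: w'].

Definition fgk_step2 (i : nat) : Prop :=
  let w := A *m fgk_z d i in
  let w' := w - \sum_(1 <= j < i.+1) fgk_m d j i *: fgk_u d j in
  [/\ fgk_z d i = invmx (L i) *m fgk_v d i,
      forall j : nat, (1 <= j <= i)%N -> fgk_m d j i = dot w (fgk_u d j),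
      fgk_m d i.+1 i = norm2 w',
      fgk_m d i.+1 i != 0
    & fgk_u d i.+1 = (fgk_m d i.+1 i)^-1 *: w'].

(* Only what FLSQR uses: step 1 for i = k + 1, which FLSMR needs in addition, is
   fgk_step1 at k.+1. *)
Definition fgk_steps (k : nat) : Prop :=
  fgk_init /\ forall i : nat, (1 <= i <= k)%N -> fgk_step1 i /\ fgk_step2 i.

Definition Zmx (k : nat) : 'M[R]_(n, k) :=
  \matrix_(r < n, i < k) fgk_z d i.+1 r 0.

(* Ordinals start at 0 whereas the sequences start at 1: hence the successors. *)
Definition Mmx (k : nat) : 'M[R]_(k.+1, k) :=
  \matrix_(j < k.+1, i < k) if (j <= i.+1)%N then fgk_m d j.+1 i.+1 else 0.

Definition Tmx (k : nat) : 'M[R]_k :=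
  \matrix_(j < k, i < k) if (j <= i)%N then fgk_t d j.+1 i.+1 else 0.

Definition e1 (k : nat) : 'cV[R]_k.+1 := delta_mx 0 0.

Definition flsqr_iterate (k : nat) (x : 'cV[R]_n) : Prop :=
  exists2 y : 'cV[R]_k,
    minimizes (fun=> True)
      (fun y => norm2 (Mmx k *m y - fgk_beta1 d *: e1 k) ^+ 2) y
    & x = x0 + Zmx k *m y.

Definition flsmr_iterate (k : nat) (x : 'cV[R]_n) : Prop :=
  exists2 y : 'cV[R]_k,
    minimizes (fun=> True)
      (fun y => norm2 (Tmx k.+1 *m Mmx k *m y
                       - (fgk_beta1 d * fgk_t d 1%N 1%N) *: e1 k) ^+ 2) y
    & x = x0 + Zmx k *m y.

Definition search_space (k : nat) (x : 'cV[R]_n) : Prop :=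
  x - x0 \in <<[seq fgk_z d i | i <- iota 1 k]>>%VS.

End FGK.

(* Main.v *)
(* The process is Gram-Schmidt applied to r_0, A z_1, A z_2, ... and to
   A^T u_1, A^T u_2, ..., so U_{k+1} and V_{k+1} have orthonormal columns and
   left multiplication by them preserves the Euclidean norm.  For
   x = x_0 + Z_k y one has A x - b = U_{k+1} (M_k y - beta_1 e_1) and
   A^T (A x - b) = V_{k+1} (T_{k+1} M_k y - beta_1 t_11 e_1), so minimizing the
   projected norm over y is minimizing the full norm over the affine space. *)
Require Import Defs.
From mathcomp Require Import all_boot all_order all_algebra.
From mathcomp Require Import reals.

Local Open Scope ring_scope.

Set Implicit Arguments.
Unset Strict Implicit.
Unset Printing Implicit Defensive.

Import Order.TTheory GRing.Theory Num.Theory.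

Section Dot.
Variables (R : rcfType) (p : nat).
Implicit Types x y z : 'cV[R]_p.

Lemma dotE x y : dot x y = \sum_i x i 0 * y i 0.
Proof. by rewrite /dot mxE; apply: eq_bigr => i _; rewrite mxE. Qed.

Lemma dotC x y : dot x y = dot y x.
Proof. by rewrite !dotE; apply: eq_bigr => i _; rewrite mulrC. Qed.

Lemma dotBl x y z : dot (x - y) z = dot x z - dot y z.
Proof. by rewrite /dot linearB mulmxBl !mxE. Qed.

Lemma dotZl a x y : dot (a *: x) y = a * dot x y.
Proof. by rewrite /dot linearZ -scalemxAl mxE. Qed.

Lemma dot_suml I (r : seq I) (F : I -> 'cV[R]_p) y :
  dot (\sum_(i <- r) F i) y = \sum_(i <- r) dot (F i) y.
Proof. by rewrite /dot linear_sum mulmx_suml summxE. Qed.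

Lemma norm2E x : norm2 x = Num.sqrt (dot x x).
Proof. by rewrite dotE; congr Num.sqrt; apply: eq_bigr. Qed.

Lemma norm2_ge0 x : 0 <= norm2 x.
Proof. exact: sqrtr_ge0. Qed.

Lemma norm2_sqr x : norm2 x ^+ 2 = dot x x.
Proof.
rewrite norm2E sqr_sqrtr // dotE.
by apply: sumr_ge0 => i _; rewrite -expr2 sqr_ge0.
Qed.

End Dot.

Lemma norm2_isometry (R : rcfType) (p q : nat) (Q : 'M[R]_(p, q))
    (x : 'cV[R]_q) :
  Q^T *m Q = 1%:M -> norm2 (Q *m x) = norm2 x.
Proof.
move=> QQ; rewrite !norm2E /dot trmx_mul mulmxA -(mulmxA _ Q^T) QQ.
by rewrite mulmx1.
Qed.

Lemma col_matrixP (R : Type) (p q : nat) (M N : 'M[R]_(p, q)) :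
  (forall j, col j M = col j N) <-> M = N.
Proof.
split=> [MN|-> //]; apply/matrixP => i j.
by have /colP/(_ i) := MN j; rewrite !mxE.
Qed.

Lemma col_mul (R : pzSemiRingType) (p q r : nat) (M : 'M[R]_(p, q))
    (N : 'M[R]_(q, r)) j :
  col j (M *m N) = M *m col j N.
Proof. by rewrite !colE mulmxA. Qed.

Section GramSchmidt.
Variables (R : rcfType) (p : nat).
Implicit Types (w g : nat -> 'cV[R]_p) (c : nat -> nat -> R).

(** One step of normalized classical Gram-Schmidt with inputs [w], outputs [g] and coefficients [c].
    Both recurrences of the process, for the [u_i] and for the [v_i], are instances of it. *)
Definition gs_step w g c (i : nat) : Prop :=
  let w' := w i - \sum_(1 <= j < i) c j i *: g j in
  [/\ forall j : nat, (1 <= j < i)%N -> c j i = dot (w i) (g j),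
      c i i = norm2 w',
      c i i != 0
    & g i = (c i i)^-1 *: w'].

Definition colmx g N : 'M[R]_(p, N) := \matrix_(r, i) g i.+1 r 0.

Lemma mulmx_colmx g N (y : 'cV[R]_N) :
  colmx g N *m y = \sum_(j < N) y j 0 *: g j.+1.
Proof.
apply/colP => r; rewrite mxE summxE; apply: eq_bigr => j _.
by rewrite !mxE mulrC.
Qed.

(** Strong induction on the larger index: since the earlier vectors are orthonormal, subtracting the
    projections of [w i] leaves a vector orthogonal to each of them. *)
Lemma gs_orthonormal w g c N :
    (forall i, (1 <= i <= N)%N -> gs_step w g c i) ->
  forall i j, (1 <= i <= N)%N -> (1 <= j <= N)%N ->
    dot (g i) (g j) = (i == j)%:R.
Proof.
move=> gs.
suff lt_orth i : (1 <= i <= N)%N -> dot (g i) (g i) = 1 /\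
    forall j, (1 <= j < i)%N -> dot (g i) (g j) = 0.
  move=> i j /[dup] /andP[i1 _] /lt_orth[gii gi] /[dup] /andP[j1 _].
  move=> /lt_orth[_ gj]; case: (ltngtP i j) => [ij|ji|<- //].
  - by rewrite dotC gj ?i1.
  - by rewrite gi ?j1.
elim/ltn_ind: i => i IH /[dup] /andP[i1 iN] /gs [cE cii cn0 gE].
split=> [|j /andP[j1 ji]].
  rewrite gE dotZl dotC dotZl -norm2_sqr -cii mulrA -expr2 -exprMn.
  by rewrite mulVf ?expr1n.
rewrite gE dotZl dotBl dot_suml -cE ?j1 //.
(* The term of index [j] cancels [c j i]; every other term vanishes by the induction hypothesis at
   the larger of [l] and [j]. *)
rewrite (bigD1_seq j) ?mem_index_iota ?j1 ?iota_uniq //= dotZl.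
have range l : (1 <= l)%N -> (l < i)%N -> (1 <= l <= N)%N.
  by move=> -> /ltnW/leq_trans->.
have [-> _] := IH j ji (range j j1 ji).
rewrite mulr1 big_seq_cond big1 ?addr0 ?subrr ?mulr0 // => l.
rewrite mem_index_iota => /andP[/andP[l1 li] lj]; rewrite dotZl.
have [lj'|jl'|jl'] := ltngtP l j; last by rewrite jl' eqxx in lj.
- have [_ h] := IH j ji (range j j1 ji).
  by rewrite dotC h ?mulr0 ?l1.
- have [_ h] := IH l li (range l l1 li).
  by rewrite h ?mulr0 ?j1.
Qed.

Lemma gs_colmx_orthonormal w g c N :
    (forall i, (1 <= i <= N)%N -> gs_step w g c i) ->
  (colmx g N)^T *m colmx g N = 1%:M.
Proof.
move=> gs; apply/matrixP => i j; rewrite !mxE.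
have := gs_orthonormal gs (i := i.+1) (j := j.+1) (ltn_ord i) (ltn_ord j).
rewrite eqSS dotE => <-.
by apply: eq_bigr => l _; rewrite !mxE.
Qed.

Lemma gs_expand w g c i : (1 <= i)%N -> gs_step w g c i ->
  w i = \sum_(1 <= j < i.+1) c j i *: g j.
Proof.
move=> i1 [_ _ cn0 gE]; rewrite big_nat_recr //= gE scalerA.
by rewrite divff // scale1r addrC subrK.
Qed.

(** Padding with zeros up to a fixed [N] turns the coefficients into a full column of a triangular
    or Hessenberg matrix. *)
Lemma gs_expand_ord w g c N i : (1 <= i <= N)%N -> gs_step w g c i ->
  w i = \sum_(j < N) (if (j < i)%N then c j.+1 i else 0) *: g j.+1.
Proof.
move=> /andP[i1 iN] /(gs_expand i1) ->.
rewrite big_add1 /= (big_nat_widen _ _ N) // big_mkord big_mkcond /=.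
by apply: eq_bigr => j _; case: ifP => // _; rewrite scale0r.
Qed.

End GramSchmidt.

Section FGK.
Variables (R : rcfType) (m n : nat) (A : 'M[R]_(m, n)).
Variables (b : 'cV[R]_m) (x0 : 'cV[R]_n) (L : nat -> 'M[R]_n).
Variables (d : fgk_data R m n) (k : nat).

Lemma ZmxE : Zmx d k = colmx (fgk_z d) k. Proof. by []. Qed.

Lemma search_spaceP x :
  search_space x0 d k x <-> exists y, x = x0 + Zmx d k *m y.
Proof.
pose X := [tuple of map (fgk_z d) (iota_tuple k 1)].
have XE (i : 'I_k) : X`_i = fgk_z d i.+1.
  by rewrite /= (nth_map 0%N) ?size_iota // nth_iota.
rewrite /search_space; split=> [xX|[y ->]].
  (* [coord] supplies coefficients even when the [z_i] are linearly dependent. *)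
  exists (\col_i coord X i (x - x0)).
  rewrite ZmxE mulmx_colmx; apply/eqP; rewrite addrC -subr_eq; apply/eqP.
  rewrite {1}(coord_span (X := X) xX); apply: eq_bigr => i _.
  by rewrite mxE XE.
rewrite addrC addKr ZmxE mulmx_colmx; apply: memv_suml => i _.
apply/memvZ/memv_span/map_f.
by rewrite mem_iota /= add1n ltnS.
Qed.

(** Common core of both claims: every point of the search space is [x0 + Zmx d k *m y], and the
    isometry [Q] drops out of the norm. *)
Lemma minimizes_projected (q r : nat) (f : 'cV[R]_n -> 'cV[R]_q)
    (Q : 'M[R]_(q, r)) (N : 'M[R]_(r, k)) (c : 'cV[R]_r) (y : 'cV[R]_k) :
    Q^T *m Q = 1%:M ->
    (forall y, f (x0 + Zmx d k *m y) = Q *m (N *m y - c)) ->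
    minimizes (fun=> True) (fun y => norm2 (N *m y - c) ^+ 2) y ->
  minimizes (search_space x0 d k) (fun x => norm2 (f x)) (x0 + Zmx d k *m y).
Proof.
move=> QQ fE [_ miny]; split; first by apply/search_spaceP; exists y.
move=> _ /search_spaceP[y' ->]; rewrite !fE !norm2_isometry //.
(* The projected problem minimizes a squared norm; squaring preserves order on nonnegative reals. *)
by rewrite -(ler_pXn2r (n := 2)) ?nnegrE ?norm2_ge0 //; apply: miny.
Qed.

(* u_1 comes from r_0 and u_{i+1} from A z_i, hence the shift of index. *)
Definition gs_w (i : nat) : 'cV[R]_m :=
  if i is i'.+2 then A *m fgk_z d i'.+1 else b - A *m x0.

(** The triangular factor of [[r_0, A z_1, ..., A z_k]]: [beta_1 e_1] followed by the columns of
    [M_k]. *)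
Definition gs_c (j i : nat) : R :=
  if i is i'.+2 then fgk_m d j i'.+1 else fgk_beta1 d.

Hypothesis d_steps : fgk_steps A b x0 L d k.

Lemma fgk_u_gs i : (1 <= i <= k.+1)%N -> gs_step gs_w (fgk_u d) gs_c i.
Proof.
case: d_steps => -[bE b0 u1] steps; case: i => [//|[_|i ik]].
  rewrite /gs_step big_geq //= subr0; split=> //.
  by case.
by have [//|_ [_ mE mii m0 uE]] := steps i.+1; split.
Qed.

Lemma fgk_U_orthonormal :
  (colmx (fgk_u d) k.+1)^T *m colmx (fgk_u d) k.+1 = 1%:M.
Proof. exact: gs_colmx_orthonormal fgk_u_gs. Qed.

(** Combines [A Z_k = U_{k+1} M_k] with [r_0 = beta_1 u_1]. *)
Lemma fgk_residual (y : 'cV[R]_k) :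
  A *m (x0 + Zmx d k *m y) - b =
  colmx (fgk_u d) k.+1 *m (Mmx d k *m y - fgk_beta1 d *: e1 R k).
Proof.
have AZ : A *m Zmx d k = colmx (fgk_u d) k.+1 *m Mmx d k.
  apply/col_matrixP => i; rewrite !col_mul mulmx_colmx.
  have -> : col i (Zmx d k) = fgk_z d i.+1 by apply/colP => r; rewrite !mxE.
  (* Column [i], counted from 0, is [A z_{i+1}], the Gram-Schmidt input of index [i.+2]; the cutoff
     [j < i.+2] is then the Hessenberg pattern of [Mmx]. *)
  have ik : (1 <= i.+2 <= k.+1)%N := ltn_ord i.
  rewrite [LHS](gs_expand_ord ik (fgk_u_gs ik)).
  by apply: eq_bigr => j _; rewrite !mxE ltnS.
have r0E : b - A *m x0 = fgk_beta1 d *: fgk_u d 1%N.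
  by case: d_steps => -[_ b0 ->] _; rewrite scalerA divff // scale1r.
rewrite mulmxBr (mulmxDr A) [A *m (_ *m y)]mulmxA AZ -!mulmxA -scalemxAr.
have -> : colmx (fgk_u d) k.+1 *m e1 R k = fgk_u d 1%N.
  by rewrite -colE; apply/colP => r; rewrite !mxE.
by rewrite -r0E opprB addrAC addrC.
Qed.

Hypothesis d_last : fgk_step1 A d k.+1.

Lemma fgk_v_gs i : (1 <= i <= k.+1)%N ->
  gs_step (fun i => A^T *m fgk_u d i) (fgk_v d) (fgk_t d) i.
Proof.
move=> /andP[i1]; rewrite leq_eqVlt => /orP[/eqP-> //|ik].
by case: d_steps => _ /(_ i); rewrite i1 -ltnS => /(_ ik)[].
Qed.

Lemma fgk_V_orthonormal :
  (colmx (fgk_v d) k.+1)^T *m colmx (fgk_v d) k.+1 = 1%:M.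
Proof. exact: gs_colmx_orthonormal fgk_v_gs. Qed.

(** Applies [A^T U_{k+1} = V_{k+1} T_{k+1}] to the factored residual. *)
Lemma fgk_normal_residual (y : 'cV[R]_k) :
  A^T *m (A *m (x0 + Zmx d k *m y) - b) =
  colmx (fgk_v d) k.+1 *m (Tmx d k.+1 *m Mmx d k *m y
                           - (fgk_beta1 d * fgk_t d 1 1) *: e1 R k).
Proof.
have AU : A^T *m colmx (fgk_u d) k.+1 = colmx (fgk_v d) k.+1 *m Tmx d k.+1.
  apply/col_matrixP => i; rewrite !col_mul mulmx_colmx.
  have -> : col i (colmx (fgk_u d) k.+1) = fgk_u d i.+1.
    by apply/colP => r; rewrite !mxE.
  have ik : (1 <= i.+1 <= k.+1)%N := ltn_ord i.
  rewrite [LHS](gs_expand_ord ik (fgk_v_gs ik)).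
  by apply: eq_bigr => j _; rewrite !mxE ltnS.
(* The first column of an upper triangular matrix is a multiple of [e_1], which yields the factor
   [t_11] in the FLSMR right-hand side. *)
have Te1 : Tmx d k.+1 *m e1 R k = fgk_t d 1 1 *: e1 R k.
  rewrite -colE; apply/colP => j; rewrite !mxE leqn0 eqxx andbT.
  have [->|j0] := eqVneq j 0; first by rewrite mulr1.
  by rewrite ifN ?mulr0.
rewrite fgk_residual mulmxA AU -!mulmxA mulmxBr -scalemxAr Te1.
by rewrite scalerA.
Qed.

End FGK.

Unset Implicit Arguments.

Theorem proposition3p1 (R : realType) (m n : nat)
  (A : 'M[R]_(m, n)) (b : 'cV[R]_m) (x0 : 'cV[R]_n)
  (L : nat -> 'M[R]_n)
  (L_unit : forall i : nat, (1 <= i)%N -> L i \in unitmx)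
  (k : nat) (d : fgk_data R m n)
  (d_steps : fgk_steps A b x0 L d k) :
  (forall x : 'cV[R]_n, flsqr_iterate x0 d k x ->
     minimizes (search_space x0 d k) (fun x' => norm2 (A *m x' - b)) x)
  /\
  (fgk_step1 A d k.+1 ->
   forall x : 'cV[R]_n, flsmr_iterate x0 d k x ->
     minimizes (search_space x0 d k) (fun x' => norm2 (A^T *m (A *m x' - b))) x).
Proof.
split=> [x [y miny ->]|last x [y miny ->]].
- apply: (minimizes_projected (f := fun x => A *m x - b)) miny.
    exact: fgk_U_orthonormal d_steps.
  exact: fgk_residual d_steps.
- apply: (minimizes_projected (f := fun x => A^T *m (A *m x - b))) miny.
    exact: fgk_V_orthonormal d_steps last.
  exact: fgk_normal_residual d_steps last.
Qed.
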